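(* The recursion coefficients $\beta_n,\gamma_n$ of the Gauss hypergeometric discrete orthogonal polynomials, i.e. those orthogonal with respect to $w(k)=\frac{(a)_k(b)_k}{(c+1)_k}\frac{\eta^k}{k!}$, $k\in\mathbb N_0$, satisfy, for all $n\in\mathbb N_0$, with $\gamma_0=0$ and $\beta_{-1}=0$, the Laguerre--Freud relations $$(\eta^2-1)\big((\beta_{n+1}+\beta_n)\gamma_{n+1}-(\beta_{n-1}+\beta_n)\gamma_n\big)+\eta\big(\beta_n(2\beta_n+a+b+c)+2(\gamma_{n+1}+\gamma_n)+n(a+b-c+n-1)+ab\big)$$ $$+(\eta+1)\Big(\big(\eta(a+b)-c+(\eta+1)n\big)(\gamma_{n+1}-\gamma_n)+(\eta+1)\gamma_n\Big)=0,$$ and $$(\eta+1)\big((1-n)\beta_n+(n+1)\beta_{n+1}\big)+(\eta-1)\big(\gamma_{n+2}-\gamma_n+\beta_{n+1}^2-\beta_n^2+n\big)+(\eta(a+b)-c)(\beta_{n+1}-\beta_n)+\eta(a+b)+c=0.$$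
   Context: $\mathbb N_0=\{0,1,2,\dots\}$; $(x)_k=x(x+1)\cdots(x+k-1)$. The parameters $a,b,c,\eta$ are real, $\eta\notin\{0,-1\}$, $c+1\notin\{0,-1,-2,\dots\}$, such that all moments $\rho_n=\sum_{k\ge0}k^nw(k)$ converge absolutely and all Hankel determinants $\det(\rho_{i+j})_{i,j=0}^{k-1}$, $k\ge1$, are nonzero. Then there are monic orthogonal polynomials $P_n$, $\deg P_n=n$, with $\sum_{k\ge0}P_n(k)P_m(k)w(k)=\delta_{n,m}H_n$, $H_n\ne0$; the recursion coefficients are defined by $zP_n(z)=P_{n+1}(z)+\beta_nP_n(z)+\gamma_nP_{n-1}(z)$, $P_{-1}=0$, $P_0=1$. *)

(* Defs.v *)
From HB Require Import structures.
From mathcomp Require Import all_boot all_order all_algebra.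
From mathcomp Require Import all_classical all_reals all_analysis.

Set Implicit Arguments.
Unset Strict Implicit.
Unset Printing Implicit Defensive.

Import Order.TTheory GRing.Theory Num.Theory.
Import numFieldNormedType.Exports.

Local Open Scope classical_set_scope.
Local Open Scope ring_scope.

Definition pochhammer (R : realType) (x : R) (k : nat) : R :=
  \prod_(i < k) (x + i%:R).

Definition gauss_weight (R : realType) (a b c eta : R) (k : nat) : R :=
  pochhammer a k * pochhammer b k / pochhammer (c + 1) k
    * (eta ^+ k / (k`!)%:R).

(* A divergent series would get an unspecified value here; convergence is
   provided by [moments_abs_cvg]. *)
Definition moment (R : realType) (w : nat -> R) (n : nat) : R :=
  limn (series (fun k : nat => k%:R ^+ n * w k)).

Definition moments_abs_cvg (R : realType) (w : nat -> R) : Prop :=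
  forall n : nat, cvgn [normed series (fun k : nat => k%:R ^+ n * w k)].

Definition hankel (R : realType) (w : nat -> R) (k : nat) : 'M[R]_k :=
  \matrix_(i < k, j < k) moment w (i + j).

Definition monic_orthogonal (R : realType) (w : nat -> R)
    (P : nat -> {poly R}) (H : nat -> R) : Prop :=
  [/\ forall n, P n \is monic,
      forall n, size (P n) = n.+1,
      forall n m, limn (series (fun k : nat =>
                      (P n).[k%:R] * (P m).[k%:R] * w k))
                  = (n == m)%:R * H n
    & forall n, H n != 0].

(* [prev_term u n] is u_{n-1}, with the convention u_{-1} = 0. *)
Definition prev_term (V : nmodType) (u : nat -> V) (n : nat) : V :=
  if n is m.+1 then u m else 0.

(* At n = 0 the relation leaves [gamma 0] free, so its value is fixed here. *)
Definition recursion_coefficients (R : realType) (P : nat -> {poly R})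
    (beta gamma : nat -> R) : Prop :=
  gamma 0%N = 0 /\
  forall n, 'X * P n = P n.+1 + beta n *: P n + gamma n *: prev_term P n.

(* Main.v *)
Require Import Defs.
From HB Require Import structures.
From mathcomp Require Import all_boot all_order all_algebra.
From mathcomp Require Import all_classical all_reals all_analysis.
From mathcomp Require Import ring.
Import Order.TTheory GRing.Theory Num.Theory.
Import numFieldNormedType.Exports.
Local Open Scope ring_scope.

(* Writing theta(z) = z (z + c) and sigma(z) = eta (z + a) (z + b), the weight
   satisfies theta(k + 1) w(k + 1) = sigma(k) w(k), so summation by shifting
   gives L(theta p) = L(sigma p(z + 1)) for the functional L p = sum_k p(k) w(k).
   Hence psi(n, m) := L(theta P_n P_m(z - 1)) = L(sigma P_n(z + 1) P_m), and each
   entry with |n - m| <= 1 can be read off the leading coefficients of a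
   polynomial of degree at most max(n, m) + 2.  The two evaluations of psi(n, n)
   give an identity involving the sum of the first beta's; its difference in n
   is the second relation.  Inserting a factor z before shifting relates
   psi(n, n), psi(n, n +- 1) and psi(n +- 1, n), which together with the diagonal
   identity is the first relation. *)

(** * Three-term recursions: subleading coefficients and their change under translation *)

Section ThreeTermRecursion.
Context {F : fieldType}.
Implicit Types (beta gamma : nat -> F) (Q : nat -> {poly F}).

Definition three_term beta gamma Q : Prop :=
  Q 0%N = 1 /\
  forall n, Q n.+1 = ('X - (beta n)%:P) * Q n - gamma n *: prev_term Q n.

(** Coefficients of degree [n - 1] and [n - 2] of the [n]-th polynomial, read off the recursion; the
    first is minus the sum of the first [n] values of [beta]. *)
Fixpoint subleading1 beta n : F :=
  if n is m.+1 then subleading1 beta m - beta m else 0.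

Fixpoint subleading2 beta gamma n : F :=
  if n is m.+1
  then subleading2 beta gamma m - beta m * subleading1 beta m - gamma m
  else 0.

Lemma three_term_lead beta gamma Q n : three_term beta gamma Q ->
  (size (Q n) <= n.+1)%N /\ (Q n)`_n = 1.
Proof.
move=> [Q0 QS]; have [n2] := ubnP n; elim: n2 n => // n2 IH [|n] lt_n.
  by rewrite Q0 size_poly1 coef1.
have [szn ln] := IH n lt_n.
have szp : (size (prev_term Q n) <= n)%N.
  case: n lt_n {szn ln} => [|n] lt_n /=; first by rewrite size_poly0.
  by have [] := IH n (ltnW lt_n).
have coefS j : (n < j)%N -> (Q n.+1)`_j = (Q n)`_j.-1.
  move=> ltnj; rewrite QS mulrBl !coefB coefXM coefCM coefZ.
  rewrite (leq_sizeP _ _ szn j ltnj) (leq_sizeP _ _ szp j (ltnW ltnj)).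
  by rewrite !mulr0 !subr0; case: j ltnj.
split; last by rewrite coefS.
apply/leq_sizeP => [[|j]] // ltj; rewrite coefS ?(ltnW ltj) //=.
exact: (leq_sizeP _ _ szn).
Qed.

(* Multiplying by a power of 'X makes the coefficients of degree [n - 1] and
   [n - 2] available for small [n], where they are 0. *)
Lemma three_term_subleading beta gamma Q n : gamma 0%N = 0 ->
  three_term beta gamma Q ->
  ('X * Q n)`_n = subleading1 beta n /\
  ('X^2 * Q n)`_n = subleading2 beta gamma n.
Proof.
move=> g0 tQ; have [Q0 QS] := tQ; elim: n => [|n [IH1 IH2]].
  by rewrite coefXM coefXnM.
have [szn ln] := three_term_lead _ _ _ n tQ.
(* At [n = 0] the previous polynomial is 0 instead of monic, and the second identity then rests on
   [gamma 0 = 0]. *)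
have [szp lp] : (size (prev_term Q n) <= n)%N /\
                gamma n * ('X^2 * prev_term Q n)`_n.+1 = gamma n.
  case: (n) => [|m] /=; first by rewrite size_poly0 g0 mul0r.
  have [szm lm] := three_term_lead _ _ _ m tQ.
  by rewrite coefXnM /= !subSS subn0 lm mulr1.
split.
  rewrite coefXM /= QS mulrBl !coefB coefCM coefZ IH1 ln mulr1.
  by rewrite (leq_sizeP _ _ szp) // mulr0 subr0.
have -> : 'X^2 * Q n.+1 = 'X * ('X^2 * Q n) - (beta n)%:P * ('X * ('X * Q n))
                          - gamma n *: ('X^2 * prev_term Q n).
  by rewrite QS -!mul_polyC; ring.
rewrite !coefB coefCM coefZ lp [('X * ('X^2 * _))`_ _]coefXM.
by rewrite [('X * ('X * _))`_ _]coefXM /= IH1 IH2.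
Qed.

(** A translated sequence again satisfies a recursion of this kind, so the same coefficient formulas
    cover [P n] at [z + 1] and at [z - 1]. *)
Lemma three_term_shift beta gamma Q e : three_term beta gamma Q ->
  three_term (fun n => beta n - e) gamma (fun n => Q n \Po ('X + e%:P)).
Proof.
move=> [Q0 QS]; split=> [|n]; first by rewrite Q0 comp_polyC.
rewrite QS comp_polyB comp_polyM comp_polyB comp_polyX comp_polyC comp_polyZ.
rewrite polyCB opprB addrA; congr (_ - _ *: _).
by case: n => [|n] //=; rewrite comp_poly0.
Qed.

Lemma subleading1_shift beta e n :
  subleading1 (fun n => beta n - e) n = subleading1 beta n + n%:R * e.
Proof.
elim: n => [|n IH] /=; first by rewrite mul0r addr0.
by rewrite IH -natr1; ring.
Qed.

(** The two correction terms are the binomial contributions of degrees [n - 1] and [n] to degree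
    [n - 2]. *)
Lemma subleading2_shift beta gamma e n :
  subleading2 (fun n => beta n - e) gamma n =
  subleading2 beta gamma n + (n%:R - 1) * e * subleading1 beta n
  + 'C(n, 2)%:R * e ^+ 2.
Proof.
elim: n => [|n IH] /=; first by rewrite mulr0 mul0r !addr0.
by rewrite IH subleading1_shift binS bin1 natrD -natr1; ring.
Qed.

End ThreeTermRecursion.

(** * Linear functionals with an orthogonal sequence *)

Section OrthogonalSequence.
Context {F : fieldType} (L : {scalar {poly F}}).
Context (beta gamma H : nat -> F) (P : nat -> {poly F}).
Implicit Types (n k : nat) (q : {poly F}) (a : F).
Hypothesis gamma0 : gamma 0%N = 0.
Hypothesis P_three_term : three_term beta gamma P.
Hypothesis P_orth : forall n m, L (P n * P m) = (n == m)%:R * H n.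

Let c1 := subleading1 beta.
Let c2 := subleading2 beta gamma.

Lemma size_cancel_lead q k : (size q <= k.+1)%N ->
  (size (q - q`_k *: P k)%R <= k)%N.
Proof.
move=> szq; have [szP lP] := three_term_lead _ _ _ k P_three_term.
apply/leq_sizeP => j; rewrite leq_eqVlt coefB coefZ => /orP[/eqP <-|ltkj].
  by rewrite lP mulr1 subrr.
by rewrite (leq_sizeP _ _ szq j ltkj) (leq_sizeP _ _ szP j ltkj) mulr0 subr0.
Qed.

Lemma orth_cancel n q k a :
  L (P n * q) = L (P n * (q - a *: P k)) + a * ((n == k)%:R * H n).
Proof. by rewrite mulrBr -scalerAr linearB linearZ /= P_orth subrK. Qed.

(** Induction on the size bound expands [q] in the [P k] with [k < n], all orthogonal to [P n]. *)
Lemma orth_low n q : (size q <= n)%N -> L (P n * q) = 0.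
Proof.
suff low k : (k <= n)%N -> (size q <= k)%N -> L (P n * q) = 0 by exact: low.
elim: k q => [|k IH] q lekn szq.
  by move: szq; rewrite size_poly_leq0 => /eqP ->; rewrite mulr0 linear0.
rewrite (orth_cancel n q k q`_k) IH ?(ltnW lekn) ?size_cancel_lead //.
by rewrite gtn_eqF // mul0r mulr0 addr0.
Qed.

Lemma orth_lead0 n q : (size q <= n.+1)%N -> L (P n * q) = q`_n * H n.
Proof.
move=> szq; rewrite (orth_cancel n q n q`_n) orth_low ?size_cancel_lead //.
by rewrite eqxx mul1r add0r.
Qed.

Lemma coef_P1 n : (P n.+1)`_n = c1 n.+1.
Proof.
rewrite /c1.
have [<- _] := three_term_subleading _ _ _ n.+1 gamma0 P_three_term.
by rewrite coefXM.
Qed.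

Lemma coef_P2 n : (P n.+2)`_n = c2 n.+2.
Proof.
rewrite /c2.
have [_ <-] := three_term_subleading _ _ _ n.+2 gamma0 P_three_term.
by rewrite coefXnM /= !subSS subn0.
Qed.

Lemma orth_lead1 n q : (size q <= n.+2)%N ->
  L (P n * q) = (q`_n - q`_n.+1 * c1 n.+1) * H n.
Proof.
move=> szq; rewrite (orth_cancel n q n.+1 q`_n.+1) orth_lead0.
  by rewrite coefB coefZ coef_P1 ltn_eqF // mul0r mulr0 addr0.
exact: size_cancel_lead.
Qed.

(** The bracket is the coordinate of [q] along [P n] in the basis [P]: removing the [P n.+2] part
    alters degrees [n + 1] and [n], then removing the [P n.+1] part alters degree [n]. *)
Lemma orth_lead2 n q : (size q <= n.+3)%N ->
  L (P n * q) = (q`_n - q`_n.+2 * c2 n.+2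
                 - (q`_n.+1 - q`_n.+2 * c1 n.+2) * c1 n.+1) * H n.
Proof.
move=> szq; rewrite (orth_cancel n q n.+2 q`_n.+2) orth_lead1.
  rewrite !coefB !coefZ coef_P1 coef_P2 ltn_eqF ?mul0r ?mulr0 ?addr0 //.
exact: size_cancel_lead.
Qed.

(** * Pairings with a monic quadratic times a second sequence sharing [gamma] *)

Section QuadraticFactor.
Variables (s t : F) (delta : nat -> F) (Q : nat -> {poly F}).
Hypothesis Q_three_term : three_term delta gamma Q.

Let quad : {poly F} := 'X^2 + s *: 'X + t%:P.
Let d1 := subleading1 delta.
Let d2 := subleading2 delta gamma.

Lemma coef_quadM n : [/\ (size (quad * Q n)%R <= n.+3)%N,
  (quad * Q n)`_n.+2 = 1, (quad * Q n)`_n.+1 = d1 n + s &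
  (quad * Q n)`_n = d2 n + s * d1 n + t].
Proof.
have [szQ lQ] := three_term_lead _ _ _ n Q_three_term.
have [e1 e2] := three_term_subleading _ _ _ n gamma0 Q_three_term.
have coefE j : (quad * Q n)`_j
    = ('X^2 * Q n)`_j + s * ('X * Q n)`_j + t * (Q n)`_j.
  by rewrite !mulrDl -scalerAl !coefD coefZ coefCM.
have Q0 := leq_sizeP _ _ szQ.
split.
- apply/leq_sizeP => j ltj; rewrite coefE coefXM coefXnM.
  case: j ltj => [|[|[|j]]] // ltj; rewrite /= !subSS subn0.
  have szj : (n < j.+1)%N by [].
  by rewrite (Q0 _ szj) (Q0 _ (leqW szj)) (Q0 _ (leqW (leqW szj))) !mulr0 !addr0.
- rewrite coefE coefXM coefXnM /= !subSS subn0 lQ !Q0 //.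
  by rewrite !mulr0 !addr0.
- have e : ('X^2 * Q n)`_n.+1 = d1 n by rewrite expr2 -mulrA coefXM.
  by rewrite coefE e coefXM /= lQ Q0 // mulr0 addr0 mulr1.
by rewrite coefE e1 e2 lQ mulr1.
Qed.

Lemma orth_quad_upper n :
  L (P n.+1 * (quad * Q n)) = (d1 n + s - c1 n.+2) * H n.+1.
Proof. by have [sz q2 q1 _] := coef_quadM n; rewrite orth_lead1 // q1 q2 mul1r. Qed.

Lemma orth_quad_diag n :
  L (P n * (quad * Q n)) =
  (d2 n + s * d1 n + t - c2 n.+2 - (d1 n + s - c1 n.+2) * c1 n.+1) * H n.
Proof.
by have [sz q2 q1 q0] := coef_quadM n; rewrite orth_lead2 // q0 q1 q2 !mul1r.
Qed.

End QuadraticFactor.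

(** Both sides evaluate [L ('X * P n * P n.+1)]: by the leading coefficient of ['X * P n], and by
    the recursion for ['X * P n.+1]. *)
Lemma norm_ratio n : H n.+1 = gamma n.+1 * H n.
Proof.
have [_ PS] := P_three_term.
have -> : H n.+1 = L (P n.+1 * ('X * P n)).
  have [sz l] := three_term_lead _ _ _ n P_three_term.
  rewrite orth_lead0 ?coefXM ?l ?mul1r //.
  by rewrite mulrC; apply: leq_trans (size_polyMleq _ _) _; rewrite size_polyX addn2.
have -> : P n.+1 * ('X * P n)
    = P n * (P n.+2 + beta n.+1 *: P n.+1 + gamma n.+1 *: P n).
  by rewrite (PS n.+1) /= -!mul_polyC; ring.
rewrite !mulrDr !linearD /= -!scalerAr !linearZ /= !P_orth eqxx.
by rewrite !ltn_eqF // !mul0r mulr0 !add0r mul1r.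
Qed.

(** * The Pearson equation and the Laguerre--Freud relations *)

Section Pearson.
Variables (c s t eta : F).
(** The constant term [0%:P] gives both quadratics the shape treated above. *)
Hypothesis pearson : forall p,
  L (('X^2 + c *: 'X + 0%:P) * p) =
  eta * L (('X^2 + s *: 'X + t%:P) * (p \Po ('X + 1%:P))).
Hypothesis H_neq0 : forall n, H n != 0.

Let theta : {poly F} := 'X^2 + c *: 'X + 0%:P.
Let sigma : {poly F} := 'X^2 + s *: 'X + t%:P.
Let up n : {poly F} := P n \Po ('X + 1%:P).
Let down n : {poly F} := P n \Po ('X + (-1)%:P).
Let up_rec := three_term_shift _ _ _ 1 P_three_term.
Let down_rec := three_term_shift _ _ _ (-1) P_three_term.
Let psi n m := L (P n * (theta * down m)).

Lemma down_up n : (down n) \Po ('X + 1%:P) = P n.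
Proof.
rewrite /down -comp_polyA comp_polyD comp_polyX comp_polyC -addrA -polyCD.
by rewrite subrr polyC0 addr0 comp_polyXr.
Qed.

Lemma psiE n m : psi n m = eta * L (P m * (sigma * up n)).
Proof.
rewrite /psi mulrCA pearson comp_polyM down_up; congr (_ * L _).
by rewrite [RHS]mulrC mulrA.
Qed.

Lemma psi_lower n : psi n.+1 n = (beta n + beta n.+1 + c - n%:R) * H n.+1.
Proof.
rewrite /psi (orth_quad_upper _ _ _ _ down_rec) subleading1_shift /c1 /=.
by congr (_ * _); ring.
Qed.

(** The theta form would pair [P n] with degree [n + 3]; the sigma form pairs [P n.+1] with degree
    [n + 2], so two coefficients suffice. *)
Lemma psi_upper n :
  psi n n.+1 = eta * (beta n + beta n.+1 + s + n%:R) * H n.+1.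
Proof.
rewrite psiE (orth_quad_upper _ _ _ _ up_rec) subleading1_shift /c1 /= -[RHS]mulrA.
by congr (_ * (_ * _)); ring.
Qed.

(** The theta and sigma evaluations of [psi n n], divided by [H n]. In [diag_up n - diag_down n] the
    sum [c1 n] survives with factor [-(eta + 1)]. *)
Let diag_down n := beta n ^+ 2 + gamma n + gamma n.+1 + c * beta n
  - n%:R * (beta n + c) + 'C(n, 2)%:R + c1 n.
Let diag_up n := eta * (beta n ^+ 2 + gamma n + gamma n.+1 + s * beta n + t
  + n%:R * (beta n + s) + 'C(n, 2)%:R - c1 n).

Lemma psi_diag n : psi n n = diag_down n * H n.
Proof.
rewrite /psi (orth_quad_diag _ _ _ _ down_rec) subleading1_shift.
rewrite subleading2_shift /diag_down /c1 /c2 /=.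
by congr (_ * _); ring.
Qed.

Lemma diag_downE n : diag_down n = diag_up n.
Proof.
apply: (mulIf (H_neq0 n)); rewrite -psi_diag psiE.
rewrite (orth_quad_diag _ _ _ _ up_rec) subleading1_shift.
rewrite subleading2_shift /diag_up /c1 /c2 /= -[RHS]mulrA.
by congr (_ * (_ * _)); ring.
Qed.

(* Two evaluations of [L (theta * X * P n * down n)]: the recursion is applied
   to [P n], or to [down n] after writing [X = (X - 1) + 1]. *)
Lemma psi_compat n :
  psi n.+1 n + gamma n * L (prev_term P n * (theta * down n)) =
  psi n n.+1
  + gamma n * L (P n * (theta * prev_term down n)) + psi n n.
Proof.
have [_ PS] := P_three_term; have [_ downS] := down_rec.
have PX : ('X - (beta n)%:P) * P n = P n.+1 + gamma n *: prev_term P n.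
  by rewrite PS subrK.
have downX : ('X - (beta n)%:P) * down n
    = down n.+1 + gamma n *: prev_term down n + down n.
  have -> : down n.+1 = ('X - (beta n - -1)%:P) * down n
                        - gamma n *: prev_term down n by exact: downS.
  by rewrite polyCB -mul_polyC; ring.
have e : P n.+1 * (theta * down n)
      + gamma n *: (prev_term P n * (theta * down n))
    = P n * (theta * down n.+1) + gamma n *: (P n * (theta * prev_term down n))
      + P n * (theta * down n).
  transitivity (('X - (beta n)%:P) * P n * (theta * down n)).
    by rewrite PX -!mul_polyC; ring.
  have -> : ('X - (beta n)%:P) * P n * (theta * down n)
      = P n * (theta * (('X - (beta n)%:P) * down n)) by ring.
  by rewrite downX -!mul_polyC; ring.
by move: (congr1 L e); rewrite !linearD !linearZ.
Qed.

Lemma laguerre_freud_beta n :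
  (eta + 1) * ((1 - n%:R) * beta n + (n%:R + 1) * beta n.+1)
    + (eta - 1) * (gamma n.+2 - gamma n + beta n.+1 ^+ 2 - beta n ^+ 2 + n%:R)
    + (eta * s - c) * (beta n.+1 - beta n) + eta * s + c = 0.
Proof.
transitivity (diag_up n.+1 - diag_down n.+1 - (diag_up n - diag_down n)).
  rewrite /diag_up /diag_down /c1 /= binS bin1 natrD -natr1; ring.
by rewrite !diag_downE !subrr.
Qed.

(** By [norm_ratio], [offdiag n.+1 * H n] is [psi n n.+1 - psi n.+1 n]. *)
Let offdiag n := gamma n * ((eta - 1) * (prev_term beta n + beta n)
  + eta * s - c + (eta + 1) * (n%:R - 1)).

Lemma offdiag_diff n : offdiag n.+1 - offdiag n + diag_down n = 0.
Proof.
apply: (mulIf (H_neq0 n)); rewrite mul0r mulrDl -psi_diag.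
have := psi_compat n; rewrite psi_lower psi_upper norm_ratio => e.
have -> : psi n n = (beta n + beta n.+1 + c - n%:R) * (gamma n.+1 * H n)
    + gamma n * L (prev_term P n * (theta * down n))
    - eta * (beta n + beta n.+1 + s + n%:R) * (gamma n.+1 * H n)
    - gamma n * L (P n * (theta * prev_term down n)).
  by rewrite e; ring.
(* At index 0 the terms with a previous polynomial vanish with [gamma 0]; otherwise they are the
   off-diagonal entries one index lower. *)
case: (n) => [|m]; first by rewrite /offdiag /= gamma0 -!natr1; ring.
rewrite /= -/(psi m m.+1) -/(psi m.+1 m) psi_lower psi_upper /offdiag /=.
by rewrite -!natr1; ring.
Qed.

Lemma natr_bin2 n : 'C(n, 2)%:R * 2 = n%:R * (n%:R - 1) :> F.
Proof.
elim: n => [|n IH]; first by rewrite !mul0r.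
by rewrite binS bin1 natrD mulrDl IH -natr1; ring.
Qed.

Lemma laguerre_freud_gamma n :
  (eta ^+ 2 - 1)
      * ((beta n.+1 + beta n) * gamma n.+1 - (prev_term beta n + beta n) * gamma n)
    + eta * (beta n * (2 * beta n + s + c) + 2 * (gamma n.+1 + gamma n)
             + n%:R * (s - c + n%:R - 1) + t)
    + (eta + 1) * ((eta * s - c + (eta + 1) * n%:R) * (gamma n.+1 - gamma n)
                   + (eta + 1) * gamma n) = 0.
Proof.
(* The diagonal terms add up to [eta * diag_down n + diag_up n], the combination in which [c1 n]
   cancels. *)
transitivity ((eta + 1) * (offdiag n.+1 - offdiag n + diag_down n)
    + (diag_up n - diag_down n)
    - eta * ('C(n, 2)%:R * 2 - n%:R * (n%:R - 1))).
  by rewrite /offdiag /diag_up /diag_down /= -natr1; ring.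
by rewrite offdiag_diff diag_downE natr_bin2 !subrr !mulr0 addr0 subr0.
Qed.

End Pearson.
End OrthogonalSequence.

(** * Summation against a weight as a linear functional on polynomials *)

Section SummationFunctional.
Context {R : realType} (w : nat -> R).
Hypothesis w_moments : moments_abs_cvg w.

Lemma cvg_poly_series (p : {poly R}) :
  cvgn (series (fun k : nat => p.[k%:R] * w k)).
Proof.
(* The free power of [k] absorbs the factor ['X] in the induction on [p]. *)
suff cvgX j : cvgn (series (fun k : nat => k%:R ^+ j * p.[k%:R] * w k)).
  by have := cvgX 0%N; under eq_fun do rewrite expr0 mul1r.
elim/poly_ind: p j => [|p x IH] j.
  have := is_cvg_seriesZ (k := 0) (normed_cvg (w_moments 0%N)); rewrite scale0r.
  by under [X in _ -> cvgn (series X)]eq_fun do rewrite horner0 mulr0 mul0r.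
have -> : (fun k : nat => k%:R ^+ j * (p * 'X + x%:P).[k%:R] * w k)
    = (fun k : nat => k%:R ^+ j.+1 * p.[k%:R] * w k)
      + x *: (fun k : nat => k%:R ^+ j * w k).
  apply/funext => k; rewrite hornerMXaddC.
  transitivity (k%:R ^+ j.+1 * p.[k%:R] * w k + x * (k%:R ^+ j * w k)) => //.
  by rewrite exprS; ring.
exact: is_cvg_seriesD (IH j.+1) (is_cvg_seriesZ (k := x) (normed_cvg (w_moments j))).
Qed.

Definition wsum (p : {poly R}) : R :=
  limn (series (fun k : nat => p.[k%:R] * w k)).

Lemma wsum_scalar : scalar wsum.
Proof.
move=> x p q; have cp := cvg_poly_series p; have cq := cvg_poly_series q.
rewrite /wsum -[x * _](lim_seriesZ x cp) -lim_seriesD //; last first.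
  exact: is_cvg_seriesZ.
congr (limn (series _)); apply/funext => k.
by rewrite hornerD hornerZ mulrDl -mulrA.
Qed.

(** As the term at 0 vanishes, the partial sums for [q] are those for [p] moved by one index. *)
Lemma wsum_shift (p q : {poly R}) :
  p.[0] = 0 -> (forall k : nat, p.[k.+1%:R] * w k.+1 = q.[k%:R] * w k) ->
  wsum p = wsum q.
Proof.
move=> p0 pq; rewrite /wsum; set u := fun k : nat => p.[_] * _.
have -> : series (fun k : nat => q.[k%:R] * w k) = (fun n => series u n.+1).
  apply/funext => n; rewrite /series /= big_nat_recl // /u p0 mul0r add0r.
  by apply: eq_bigr => k _; rewrite pq.
apply/esym/cvg_lim => //.
by rewrite cvg_shiftS; exact: cvg_poly_series.
Qed.

End SummationFunctional.

(** Each Pochhammer symbol gains one factor from [k] to [k.+1]; the condition on [c] keeps the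
    denominators nonzero. *)
Lemma gauss_weightS (R : realType) (a b c eta : R) (k : nat) :
  (forall m : nat, c + 1 != - m%:R) ->
  k.+1%:R * (k.+1%:R + c) * gauss_weight a b c eta k.+1 =
  eta * (k%:R + a) * (k%:R + b) * gauss_weight a b c eta k.
Proof.
move=> c_adm; rewrite /gauss_weight /pochhammer !big_ord_recr /=.
have ck j : c + 1 + j%:R != 0 by rewrite addr_eq0.
have pk : \prod_(i < k) (c + 1 + i%:R) != 0 by apply/prodf_neq0 => i _.
have fk : (k`!)%:R != 0 :> R by rewrite pnatr_eq0 -lt0n fact_gt0.
have k1 : k.+1%:R != 0 :> R by rewrite pnatr_eq0.
rewrite factS natrM exprS; move: (ck k) k1; rewrite -natr1 => ck' k1.
by field; rewrite k1 fk pk ck'.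
Qed.

Theorem theorem9 (R : realType) (a b c eta : R)
    (eta_neq0 : eta != 0) (eta_neqN1 : eta != -1)
    (c_adm : forall m : nat, c + 1 != - m%:R)
    (w_moments : moments_abs_cvg (gauss_weight a b c eta))
    (w_hankel : forall k : nat, (0 < k)%N ->
       \det (hankel (gauss_weight a b c eta) k) != 0)
    (P : nat -> {poly R}) (H beta gamma : nat -> R)
    (P_orth : monic_orthogonal (gauss_weight a b c eta) P H)
    (P_rec : recursion_coefficients P beta gamma) :
  forall n : nat,
    (eta ^+ 2 - 1)
        * ((beta n.+1 + beta n) * gamma n.+1 - (prev_term beta n + beta n) * gamma n)
      + eta * (beta n * (2 * beta n + a + b + c)
               + 2 * (gamma n.+1 + gamma n)
               + n%:R * (a + b - c + n%:R - 1) + a * b)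
      + (eta + 1) * ((eta * (a + b) - c + (eta + 1) * n%:R)
                       * (gamma n.+1 - gamma n)
                     + (eta + 1) * gamma n) = 0
    /\
    (eta + 1) * ((1 - n%:R) * beta n + (n%:R + 1) * beta n.+1)
      + (eta - 1) * (gamma n.+2 - gamma n + beta n.+1 ^+ 2 - beta n ^+ 2 + n%:R)
      + (eta * (a + b) - c) * (beta n.+1 - beta n)
      + eta * (a + b) + c = 0.
Proof.
move=> n; set w := gauss_weight a b c eta in w_moments P_orth *.
have [P_monic szP P_dot H_neq0] := P_orth; have [gamma0 PX] := P_rec.
pose L : {scalar {poly R}} := HB.pack (wsum w)
  (GRing.isLinear.Build _ _ _ _ _ (wsum_scalar _ w_moments)).
have tP : three_term beta gamma P.
  split=> [|m]; last by rewrite mulrBl PX -!mul_polyC; ring.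
  have := P_monic 0%N; rewrite monicE /lead_coef szP /= => /eqP lead1.
  by rewrite (size1_polyC (eq_leq (szP 0%N))) lead1.
have orth m k : L (P m * P k) = (m == k)%:R * H m.
  rewrite -P_dot /= /wsum; congr (limn (series _)); apply/funext => j.
  by rewrite hornerM.
have pearson p : L (('X^2 + c *: 'X + 0%:P) * p) =
    eta * L (('X^2 + (a + b) *: 'X + (a * b)%:P) * (p \Po ('X + 1%:P))).
  (* With [eta] moved inside [L], what remains is that theta vanishes at 0 and the weight recursion
     at each [k]. *)
  rewrite -linearZ /=; apply: wsum_shift => // [|k].
    by rewrite !hornerE; ring.
  rewrite !(hornerM, hornerD, hornerZ, hornerXn, hornerX, hornerC, horner_comp).
  rewrite natr1.
  transitivity (k.+1%:R * (k.+1%:R + c) * w k.+1 * p.[k.+1%:R]); first by ring.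
  by rewrite gauss_weightS // -/w; ring.
split.
  rewrite -[RHS](laguerre_freud_gamma L beta gamma H P gamma0 tP orth
                   c (a + b) (a * b) eta pearson H_neq0 n); ring.
exact: (laguerre_freud_beta L beta gamma H P gamma0 tP orth
          c (a + b) (a * b) eta pearson H_neq0 n).
Qed.
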